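(* Let $\mathbb{A}$ be a unital $C^*$-algebra, identified with a closed $*$-subalgebra, containing the identity, of the $C^*$-algebra $\mathcal{B}(E)$ of bounded operators on a Hilbert space $E$, and let $\Omega$ be the cone of invertible positive elements of $\mathbb{A}$. For any $a_1,\ldots,a_n\in\Omega$, we have $\Lambda(a_1,\ldots,a_n)\in\Omega$, where $\Lambda$ is the Karcher mean on the cone of positive invertible operators of $\mathcal{B}(E)$.
   Context: For positive invertible operators $a_1,\dots,a_n$ in $\mathcal{B}(E)$, the Karcher mean $\Lambda(a_1,\dots,a_n)$ is the unique positive invertible $x\in\mathcal{B}(E)$ solving the Karcher equation $\sum_{i=1}^n\log(x^{-1/2}a_ix^{-1/2})=0$ (existence and uniqueness of this solution in $\mathcal{B}(E)$ is a known result of Lawson and Lim). *)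

(* Defs.v *)
From HB Require Import structures.
From mathcomp Require Import all_boot all_order all_algebra.
From mathcomp Require Import complex.
From mathcomp Require Import all_classical all_reals all_analysis.

Set Implicit Arguments.
Unset Strict Implicit.
Unset Printing Implicit Defensive.

Import Order.TTheory GRing.Theory Num.Theory.
Import numFieldNormedType.Exports.
Local Open Scope classical_set_scope.
Local Open Scope ring_scope.

(* A complex Hilbert space is a complete normed module E over R[i] with an    *)
(* inner product dot (linear in the first argument) inducing the norm.        *)
(* Operators are functions E -> E, with the pointwise operations; algebras of *)
(* operators, including B(E), are sets of such functions.                     *)

Section Operators.
Context {R : realType} {E : completeNormedModType R[i]}.
Implicit Types (S T : E -> E) (A : set (E -> E)).

Definition bounded_operators : set (E -> E) :=
  [set T | linear T /\ exists M : R[i], forall v, `|T v| <= M * `|v|].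

(* Convergence in operator norm: the bound says that the operator norm of     *)
(* u n - T is at most e.                                                      *)
Definition norm_cvg (u : nat -> E -> E) T : Prop :=
  forall e : R[i], 0 < e ->
    \forall n \near \oo, forall v, `|u n v - T v| <= e * `|v|.

Definition is_exp T S : Prop :=
  norm_cvg (fun N => \sum_(k < N) (k`!%:R : R[i])^-1 *: (iter k T : E -> E)) S.

Definition is_inverse S T : Prop := S \o T = id /\ T \o S = id.

Variable dot : {dot E for (Num.conj : R[i] -> R[i])}.

Definition is_adjoint S T : Prop := forall u v, dot (S u) v = dot u (T v).

Record is_cstar_subalgebra A : Prop := {
  cstar_bounded : A `<=` bounded_operators;
  cstar_one : A id;
  cstar_add : forall S T, A S -> A T -> A (S + T);
  cstar_scale : forall (c : R[i]) T, A T -> A (c *: T);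
  cstar_mul : forall S T, A S -> A T -> A (S \o T);
  cstar_star : forall S, A S -> exists2 T, A T & is_adjoint S T;
  cstar_closed : forall (u : nat -> E -> E) T,
    (forall n, A (u n)) -> bounded_operators T -> norm_cvg u T -> A T }.

(* Positive elements of A are those of the form b^* b with b in A. *)
Definition positive A S : Prop :=
  exists b c, [/\ A b, A c, is_adjoint b c & S = c \o b].

Definition invertible A S : Prop := A S /\ exists2 T, A T & is_inverse S T.

Definition pos_cone A : set (E -> E) :=
  [set S | positive A S /\ invertible A S].

Definition is_sqrt S T : Prop := positive bounded_operators T /\ T \o T = S.

Definition is_inv_sqrt S T : Prop := exists2 r, is_sqrt S r & is_inverse r T.

(* The logarithm, as the inverse of exp from self-adjoint operators onto      *)
(* positive invertible ones.                                                  *)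
Definition is_log S T : Prop :=
  [/\ bounded_operators T, is_adjoint T T & is_exp T S].

Definition karcher_equation n (a : 'I_n -> E -> E) (x : E -> E) : Prop :=
  exists (s : E -> E) (l : 'I_n -> E -> E),
    [/\ is_inv_sqrt x s,
        forall i, is_log (s \o a i \o s) (l i) &
        \sum_(i < n) l i = 0].

(* By the theorem of Lawson and Lim exactly one x satisfies this when n > 0    *)
(* and the a i are positive and invertible; it is the Karcher mean.           *)
Definition is_karcher_mean n (a : 'I_n -> E -> E) (x : E -> E) : Prop :=
  pos_cone bounded_operators x /\ karcher_equation a x.

End Operators.

(* Main.v *)
Require Import Defs.
From HB Require Import structures.
From mathcomp Require Import all_boot all_order all_algebra.
From mathcomp Require Import complex.
From mathcomp Require Import all_classical all_reals all_analysis.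
From mathcomp Require Import ring lra.

Set Implicit Arguments.
Unset Strict Implicit.
Unset Printing Implicit Defensive.

Import Order.TTheory GRing.Theory Num.Theory.
Import numFieldNormedType.Exports.
Local Open Scope classical_set_scope.
Local Open Scope ring_scope.

(** The geometric means [y #_t a] are monotone and satisfy
    [(c y) #_t a = c ^ (1 - t) (y #_t a)]; hence the average
    [G_t y = n^-1 \sum_i y #_t a i] contracts the Thompson metric by the factor
    [1 - t]. If [x] solves the Karcher equation with logarithms [l i], then
    [x #_t a i = x^(1/2) exp (t l i) x^(1/2)], and because [\sum_i l i = 0] the
    linear terms cancel in [G_t x], so that [G_t x] is at distance [o(t)] from
    [x]. Therefore the iterates of [G_t] started at the identity, which stay in
    the algebra, end up at distance [o(1)] from [x] as [t -> 0], and [x] is a norm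
    limit of elements of the algebra. For [t = 2^-m] the means are iterated
    square roots, i.e. positive solutions of Riccati equations. *)

(** * The real inner product *)

(** The solution [x], its square root and the logarithms are only known to lie in [B(E)]: they may
    serve to measure the iterates, not to build them. The two limits balance because one averaging
    step costs [t * eps] while the contraction gains a proportion [t]: the recursion
    [th |-> (1 - t) * th + t * eps] settles at [eps] whatever [t] is, so a single small [t] serves a
    given accuracy. In place of spectral theory, operators are compared through quadratic forms,
    inverses and square roots come from geometrically convergent iterations, and exponentials are
    replaced by powers [(1 + l / N) ^ N] with [N = 2 ^ m], since [m] successive square roots turn
    exactly such a power into its linear factor. *)

Section HilbertSpace.
Context {R : realType} {E : completeNormedModType R[i]}.
Variable dot : {dot E for (Num.conj : R[i] -> R[i])}.
Hypothesis dot_norm : forall v : E, dot v v = `|v| ^+ 2.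

(* The real part of the inner product; for C-linear operators, symmetry and   *)
(* positivity can be tested on it, which keeps all the estimates real.        *)
Definition ip (u v : E) : R := complex.Re (dot u v).

Definition nrm (v : E) : R := complex.Re `|v|.

Local Notation "c *r v" := (real_complex R c *: v) (at level 40).

Lemma nrmE v : `|v| = real_complex R (nrm v).
Proof. by rewrite /nrm RRe_real // normr_real. Qed.

Lemma nrm_ge0 v : 0 <= nrm v.
Proof. by rewrite -lecR -nrmE normr_ge0. Qed.

Lemma ler_nrmD u v : nrm (u + v) <= nrm u + nrm v.
Proof. by rewrite -lecR rmorphD /= -!nrmE ler_normD. Qed.

Lemma nrmN v : nrm (- v) = nrm v.
Proof. by rewrite /nrm normrN. Qed.

Lemma nrmZ c v : nrm (c *r v) = `|c| * nrm v.
Proof.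
apply: complexI; rewrite -nrmE normrZ nrmE rmorphM /=; congr (_ * _).
by rewrite normc_def /= expr0n /= addr0 sqrtr_sqr.
Qed.

Lemma nrm_eq0 v : nrm v = 0 -> v = 0.
Proof. by move=> h; apply/eqP; rewrite -normr_eq0 nrmE h. Qed.

Lemma dotC u v : dot u v = (dot v u)^*.
Proof. by rewrite hermC /= expr0 mul1r. Qed.

Lemma ipC u v : ip u v = ip v u.
Proof. by rewrite /ip dotC; case: (dot v u). Qed.

Lemma ip0l v : ip 0 v = 0.
Proof. by rewrite /ip linear0l. Qed.

Lemma ipDl u v w : ip (u + v) w = ip u w + ip v w.
Proof. by rewrite /ip linearDl /=; case: (dot u w); case: (dot v w). Qed.

Lemma ipDr u v w : ip w (u + v) = ip w u + ip w v.
Proof. by rewrite ipC ipDl !(ipC _ w). Qed.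

Lemma ipNl u v : ip (- u) v = - ip u v.
Proof. by rewrite /ip linearNl /=; case: (dot u v). Qed.

Lemma ipNr u v : ip u (- v) = - ip u v.
Proof. by rewrite ipC ipNl ipC. Qed.

Lemma ipZl c u v : ip (c *r u) v = c * ip u v.
Proof.
rewrite /ip linearZl_LR /=; case: (dot u v) => a b /=.
by rewrite mul0r subr0.
Qed.

Lemma ipZr c u v : ip u (c *r v) = c * ip u v.
Proof. by rewrite ipC ipZl ipC. Qed.

Lemma ipvv v : ip v v = nrm v ^+ 2.
Proof. by rewrite /ip dot_norm nrmE -rmorphXn. Qed.

Lemma ip_inj u v : (forall w, ip u w = ip v w) -> u = v.
Proof.
move=> h; apply/eqP; rewrite -subr_eq0; apply/eqP/nrm_eq0/eqP.
by rewrite -sqrf_eq0 -ipvv ipDl ipNl h subrr.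
Qed.

Definition ipE := (ipDl, ipDr, ipNl, ipNr, ipZl, ipZr).

Lemma ip_sumr I (r : seq I) (P : pred I) (F : I -> E) u :
  ip u (\sum_(i <- r | P i) F i) = \sum_(i <- r | P i) ip u (F i).
Proof.
apply: (big_morph (ip u)) => [v w|]; first exact: ipDr.
by rewrite ipC ip0l.
Qed.

Lemma nrm_sqrD u v : nrm (u + v) ^+ 2 = nrm u ^+ 2 + 2 * ip u v + nrm v ^+ 2.
Proof. by rewrite -!ipvv !ipE (ipC v u); ring. Qed.

(** The triangle inequality is part of the normed structure; squaring it and cancelling the squares
    of the norms leaves this bound. *)
Lemma cauchy_schwarz u v : ip u v <= nrm u * nrm v.
Proof.
have := ler_nrmD u v => h.
have := nrm_sqrD u v; have := nrm_ge0 (u + v).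
have := nrm_ge0 u; have := nrm_ge0 v; nra.
Qed.

(* The complex inner product is recovered from its real part by               *)
(* [dot u v = ip u v + i ip u (i v)].                                         *)
Lemma adjoint_ip (S T : E -> E) : linear S -> linear T ->
  (forall u v, ip (S u) v = ip u (T v)) -> is_adjoint dot S T.
Proof.
move=> linS linT h u v.
have Zl (U : E -> E) (linU : linear U) c w : U (c *: w) = c *: U w.
  have U0 : U 0 = 0.
    by have := linU (-1) 0 0; rewrite scaler0 addr0 scaleN1r addNr.
  by have := linU c w 0; rewrite !addr0 U0 addr0.
have h1 := h u v; have := h u ('i%C *: v); rewrite (Zl _ linT).
move: h1; rewrite /ip !linearZr_LR /=.
by case: (dot (S u) v) => a b; case: (dot u (T v)) => a' b' /= ->; simpc => /= ->.
Qed.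

Lemma ip_adjoint (S T : E -> E) : is_adjoint dot S T ->
  forall u v, ip (S u) v = ip u (T v).
Proof. by move=> h u v; rewrite /ip h. Qed.

End HilbertSpace.

(** * Operators and their order *)

Section Operators.
Context {R : realType} {E : completeNormedModType R[i]}.
Variable dot : {dot E for (Num.conj : R[i] -> R[i])}.
Hypothesis dot_norm : forall v : E, dot v v = `|v| ^+ 2.
Implicit Types S T W P : E -> E.
Local Notation "c *r v" := (real_complex R c *: v) (at level 40).
Local Notation ip := (ip dot).
Local Notation ipvv := (ipvv dot_norm).

Definition opnorm_le T (M : R) := forall v, nrm (T v) <= M * nrm v.
Definition bounded_op T := linear T /\ exists2 M, 0 < M & opnorm_le T M.
Definition selfadj T := bounded_op T /\ forall u v, ip (T u) v = ip u (T v).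
Definition qform T v := ip (T v) v.
Definition le_op S T := forall v, qform S v <= qform T v.
(** A uniform lower bound on the form stands for positive and invertible: it mentions neither an
    inverse nor a factorisation, hence no ambient algebra. *)
Definition posdef T := selfadj T /\ exists2 m, 0 < m & forall v, m * nrm v ^+ 2 <=
  qform T v.

Lemma opDE S T v : (S + T) v = S v + T v. Proof. by []. Qed.
Lemma opNE T v : (- T) v = - T v. Proof. by []. Qed.
Lemma opZE c T v : (c *: T) v = c *: T v. Proof. by []. Qed.
Definition opE := (opDE, opNE, opZE).

Lemma lin0 T : linear T -> T 0 = 0.
Proof.
by move=> l; have := l (-1) 0 0; rewrite scaler0 addr0 scaleN1r addNr.
Qed.
Lemma linZ T c u : linear T -> T (c *: u) = c *: T u.
Proof. by move=> l; have := l c u 0; rewrite !addr0 lin0 // addr0. Qed.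
Lemma linD T u v : linear T -> T (u + v) = T u + T v.
Proof. by move=> l; have := l 1 u v; rewrite !scale1r. Qed.
Lemma linN T u : linear T -> T (- u) = - T u.
Proof. by move=> l; rewrite -scaleN1r linZ // scaleN1r. Qed.

Lemma nrm_complexZ (c : R[i]) (v : E) : nrm (c *: v) = complex.Re `|c| * nrm v.
Proof.
by rewrite /nrm normrZ nrmE !normc_def /= mulr0 subr0.
Qed.

Lemma bounded_op_bounded T : bounded_op T <-> bounded_operators T.
Proof.
split=> [[l [M M0 b]]|[l [M b]]]; split=> //.
  by exists (real_complex R M) => v; rewrite !nrmE -rmorphM lecR.
exists (`|complex.Re M| + 1); first by rewrite ltr_wpDl.
move=> v; have := b v; rewrite !nrmE lecE => /andP[_] /=.
case: M {b} => a b /=; rewrite mulr0 subr0 => h.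
have := ler_norm a; have := nrm_ge0 v; nra.
Qed.

Lemma bounded_op_id : bounded_op id.
Proof. by split=> //; exists 1 => // v; rewrite mul1r. Qed.

Lemma bounded_opD S T : bounded_op S -> bounded_op T -> bounded_op (S + T).
Proof.
move=> [lS [M M0 bS]] [lT [N N0 bT]]; split.
  by move=> c u v; rewrite !opE lS lT scalerDr addrACA.
exists (M + N); first by rewrite addr_gt0.
move=> v; rewrite opE; apply: le_trans (ler_nrmD _ _) _.
by rewrite mulrDl lerD.
Qed.

Lemma bounded_opZ c T : bounded_op T -> bounded_op (c *: T).
Proof.
move=> [lT [N N0 bT]]; split.
  by move=> d u v; rewrite !opE lT scalerDr !scalerA mulrC.
have c0 : 0 <= complex.Re `|c| :> R by rewrite -lecR RRe_real ?normr_real ?normr_ge0.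
exists ((complex.Re `|c| + 1) * N); first by rewrite mulr_gt0 // ltr_wpDl.
move=> v; rewrite opE nrm_complexZ.
by have := bT v; have := nrm_ge0 (T v); nra.
Qed.

Lemma bounded_op_comp S T : bounded_op S -> bounded_op T -> bounded_op (S \o T).
Proof.
move=> [lS [M M0 bS]] [lT [N N0 bT]]; split.
  by move=> c u v; rewrite /= lT lS.
exists (M * N); first by rewrite mulr_gt0.
by move=> v /=; apply: le_trans (bS _) _; rewrite -mulrA ler_pM2l.
Qed.

Lemma selfadj_id : selfadj id.
Proof. by split; first exact: bounded_op_id. Qed.

Lemma selfadjD S T : selfadj S -> selfadj T -> selfadj (S + T).
Proof.
move=> [bS aS] [bT aT]; split; first exact: bounded_opD.
by move=> u v; rewrite !opE !ipE aS aT.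
Qed.

Lemma selfadjZ c T : selfadj T -> selfadj (real_complex R c *: T).
Proof.
move=> [bT aT]; split; first exact: bounded_opZ.
by move=> u v; rewrite !opE !ipE aT.
Qed.

Lemma selfadj_conj S T : selfadj S -> selfadj T -> selfadj (S \o T \o S).
Proof.
move=> [bS aS] [bT aT]; split; first exact/bounded_op_comp/bS/bounded_op_comp.
by move=> u v; rewrite /= aS aT aS.
Qed.

Lemma selfadjX n T : selfadj T -> selfadj (iter n T).
Proof.
move=> hT; have [bT aT] := hT.
elim: n => [|n [IH1 IH2]]; first exact: selfadj_id.
split; first exact: bounded_op_comp.
by move=> u v; rewrite iterS aT IH2 -iterSr.
Qed.

Lemma qformD S T v : qform (S + T) v = qform S v + qform T v.
Proof. by rewrite /qform opE !ipE. Qed.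

Lemma qformZ c T v : qform (real_complex R c *: T) v = c * qform T v.
Proof. by rewrite /qform opE !ipE. Qed.

Lemma qform_ub T M v : opnorm_le T M -> qform T v <= M * nrm v ^+ 2.
Proof.
move=> b; apply: le_trans (cauchy_schwarz dot_norm _ _) _.
by have := b v; have := nrm_ge0 v; nra.
Qed.

Lemma qform_diff_ub S T e v : (forall v, nrm (S v - T v) <= e * nrm v) ->
  qform S v <= qform T v + e * nrm v ^+ 2.
Proof.
move=> /(_ v) b; have := cauchy_schwarz dot_norm (S v - T v) v.
rewrite !ipE -/(qform S v) -/(qform T v).
have := nrm_ge0 v; nra.
Qed.

Lemma posdef_id : posdef id.
Proof.
by split; [exact: selfadj_id | exists 1 => // v; rewrite mul1r /qform ipvv].
Qed.

Lemma posdefD S T : posdef S -> posdef T -> posdef (S + T).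
Proof.
move=> [sS [m m0 hS]] [sT [k k0 hT]]; split; first exact: selfadjD.
exists (m + k); first exact: addr_gt0.
by move=> v; rewrite qformD mulrDl lerD.
Qed.

Lemma posdefZ c T : 0 < c -> posdef T -> posdef (real_complex R c *: T).
Proof.
move=> c0 [sT [k k0 hT]]; split; first exact: selfadjZ.
exists (c * k); first exact: mulr_gt0.
by move=> v; rewrite qformZ -mulrA ler_pM2l.
Qed.

Lemma posdef_ge0 T : posdef T -> forall v, 0 <= qform T v.
Proof.
move=> [_ [m m0 h]] v; apply: le_trans (h v).
by rewrite mulr_ge0 ?sqr_ge0 // ltW.
Qed.

Lemma qform_lower_bound T m : (forall v, m * nrm v ^+ 2 <= qform T v) ->
  forall v, m * nrm v <= nrm (T v).
Proof.
move=> h v; have := le_trans (h v) (cauchy_schwarz dot_norm _ _).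
have := nrm_ge0 v; rewrite le_eqVlt => /orP[/eqP<- _|v0].
  by rewrite mulr0 nrm_ge0.
by rewrite expr2 mulrA ler_pM2r.
Qed.

Lemma posdef_conj S T m : selfadj S -> 0 < m -> (forall v, m * nrm v <= nrm (S v)) ->
  posdef T -> posdef (S \o T \o S).
Proof.
move=> sS m0 hS [sT [k k0 hT]]; split; first exact: selfadj_conj.
exists (k * m ^+ 2); first by rewrite mulr_gt0 // exprn_gt0.
move=> v; have [_ aS] := sS.
have -> : qform (S \o T \o S) v = qform T (S v) by rewrite /qform /= aS.
apply: le_trans (hT _); rewrite -mulrA ler_pM2l // -exprMn ler_sqr ?nnegrE ?nrm_ge0 //.
by rewrite mulr_ge0 ?nrm_ge0 // ltW.
Qed.

Lemma posdef_lower_bound T : posdef T -> exists2 m, 0 < m & forall v, m * nrm v <= nrm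
  (T v).
Proof. by move=> [_ [m m0 h]]; exists m => //; apply: qform_lower_bound. Qed.

Lemma posdef_sqr S m : selfadj S -> 0 < m -> (forall v, m * nrm v <= nrm (S v)) ->
  posdef (S \o S).
Proof. by move=> sS m0 h; apply: (posdef_conj sS m0 h posdef_id). Qed.

(* Expand [0 <= qform P (v - P v / K)]. *)
Lemma pos_op_sq P K : selfadj P -> 0 < K -> (forall v, 0 <= qform P v) -> opnorm_le P K ->
  forall v, nrm (P v) ^+ 2 <= K * qform P v.
Proof.
move=> [[lP _] aP] K0 pP bP v.
have := pP (v - K^-1 *r P v).
rewrite /qform (linD _ _ lP) (linN _ lP) (linZ _ _ lP) !ipE (aP (P v) v) ipvv -/(qform
  P v) -/(qform P (P v)) => h.
have := qform_ub (P v) bP; set a := qform P (P v) in h *; set b := nrm (P v) ^+ 2 in h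
  * => h2.
have {h2} : K^-1 * (K^-1 * a) <= K^-1 * b.
  by rewrite ler_pM2l ?invr_gt0 // ler_pdivrMl.
move=> h2; have {h2} {}h : K^-1 * b <= qform P v by lra.
by move: h; rewrite ler_pdivrMl.
Qed.

(* Polarization: [4 ip (T v) w = qform T (v + w) - qform T (v - w)], [w = T v / c]. *)
Lemma opnorm_le_qform T c : selfadj T -> 0 < c ->
  (forall v, `|qform T v| <= c * nrm v ^+ 2) -> opnorm_le T c.
Proof.
move=> [[lT _] aT] c0 h v; set w := c^-1 *r T v.
have h1 := h (v + w); have h2 := h (v - w); move: h1 h2.
rewrite !ler_norml => /andP[_ h1] /andP[h2 _].
have e1 : qform T (v + w) - qform T (v - w) = 4 * (c^-1 * nrm (T v) ^+ 2).
  rewrite /qform !(linD _ _ lT) !(linN _ lT) /w !(linZ _ _ lT) !ipE !ipvv.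
  rewrite (ipC _ (T (T v)) v) -aT ipvv; ring.
have e2 : nrm (v + w) ^+ 2 + nrm (v - w) ^+ 2 = 2 * nrm v ^+ 2 + 2 * (c^-1 ^+ 2 * nrm
  (T v) ^+ 2).
  rewrite !(nrm_sqrD dot_norm) nrmN ipNr /w nrmZ exprMn real_normK ?num_real //.
  by ring.
have e3 : c * c^-1 = 1 by rewrite mulfV // gt_eqF.
have := nrm_ge0 v; have := nrm_ge0 (T v).
set a := nrm (T v) in e1 e2 *; set b := nrm v in e1 e2 *; set d := c^-1 in e1 e2 e3 *.
move=> a0 b0.
have h3 : 2 * (d * a ^+ 2) <= c * b ^+ 2 + d * a ^+ 2.
  have : c * (d ^+ 2 * a ^+ 2) = d * a ^+ 2 by rewrite expr2 -[RHS]mul1r -e3; ring.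
  nra.
have h4 : a ^+ 2 <= (c * b) ^+ 2.
  have : c * (d * a ^+ 2) = a ^+ 2 by rewrite mulrA e3 mul1r.
  nra.
by rewrite -ler_sqr // nnegrE // mulr_ge0 // ltW.
Qed.

Lemma inverseKV T W : is_inverse T W -> forall v, T (W v) = v.
Proof. by move=> [h _] v; have := congr1 (fun f => f v) h. Qed.

Lemma inverseK T W : is_inverse T W -> forall v, W (T v) = v.
Proof. by move=> [_ h] v; have := congr1 (fun f => f v) h. Qed.

Lemma inverse_bounded_op T W m : bounded_op T -> 0 < m -> (forall v, m * nrm v <= nrm
  (T v)) ->
  is_inverse T W -> bounded_op W.
Proof.
move=> [lT _] m0 h iW; split.
  move=> c u v; apply: (can_inj (inverseK iW)).
  by rewrite lT !(inverseKV iW).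
exists m^-1; first by rewrite invr_gt0.
by move=> v; have := h (W v); rewrite (inverseKV iW) ler_pdivlMl.
Qed.

Lemma inverse_selfadj T W m : selfadj T -> 0 < m -> (forall v, m * nrm v <= nrm (T v)) ->
  is_inverse T W -> selfadj W.
Proof.
move=> [bT aT] m0 h iW; split; first exact: (inverse_bounded_op bT m0 h iW).
by move=> u v; rewrite -{1}(inverseKV iW v) -aT (inverseKV iW).
Qed.

(** For [u = W v], the form [qform W v] equals [qform T u], and [nrm v <= M * nrm u]; hence the
    constant [m / M ^ 2]. *)
Lemma inverse_posdef T W : posdef T -> is_inverse T W -> posdef W.
Proof.
move=> pT iW; have [m0 m00 h0] := posdef_lower_bound pT.
have [sT [m mp h]] := pT; have [[lT [M M0 bT]] aT] := sT.
split; first exact: (inverse_selfadj sT m00 h0 iW).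
exists (m / M ^+ 2); first by rewrite divr_gt0 // exprn_gt0.
move=> v.
have -> : qform W v = qform T (W v) by rewrite /qform (inverseKV iW) ipC.
apply: le_trans (h _); rewrite -mulrA ler_pM2l // mulrC ler_pdivrMr ?exprn_gt0 //.
rewrite mulrC -exprMn ler_sqr ?nnegrE ?nrm_ge0 //; last by rewrite mulr_ge0 ?nrm_ge0 //
  ltW.
by have := bT (W v); rewrite (inverseKV iW).
Qed.

(* [qform T' v = sup_u (2 ip u v - qform T u)] when [T'] is the inverse of [T]. *)
Lemma inverse_antitone S T S' T' : posdef S -> posdef T -> is_inverse S S' ->
  is_inverse T T' -> le_op S T -> le_op T' S'.
Proof.
move=> pS pT iS iT h v.
set p := T' v; set q := S' v.
have h1 := posdef_ge0 pS (q - p).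
have h2 := h p; move: h1 h2.
have [[[lS _] aS] _] := pS.
have e : ip (S p) q = ip p v by rewrite aS (inverseKV iS).
rewrite /qform (linD _ _ lS) (linN _ lS) !ipE e (inverseKV iS) (inverseKV iT).
rewrite -/p -/q (ipC _ v p) (ipC _ v q); lra.
Qed.

End Operators.

(** * Monotonicity of geometric means *)

Section GeometricMeans.
Context {R : realType} {E : completeNormedModType R[i]}.
Variable dot : {dot E for (Num.conj : R[i] -> R[i])}.
Hypothesis dot_norm : forall v : E, dot v v = `|v| ^+ 2.
Implicit Types a b g h w y z : E -> E.
Local Notation "c *r v" := (real_complex R c *: v) (at level 40).
Local Notation ip := (ip dot).
Local Notation ipvv := (ipvv dot_norm).
Local Notation qform := (qform dot).
Local Notation posdef := (posdef dot).
Local Notation le_op := (le_op dot).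

(* If [h - g] failed to be positive, let [P = h - g + mu y >= 0] with [mu]    *)
(* nearly minimal; at a vector where [P v] is small, [w (h - g) v] is nearly  *)
(* [- mu v], so [ip (w (h - g) v) ((h + g) v) < 0]; but this number is        *)
(* [qform (h w h - g w g) v].                                                 *)
Lemma riccati_mono_step y w g h : posdef y -> is_inverse y w -> posdef g -> posdef h ->
  le_op (g \o w \o g) (h \o w \o h) ->
  forall mu0, 0 < mu0 -> exists2 kappa, 0 < kappa &
    forall mu, 0 < mu -> mu <= mu0 ->
      (forall v, 0 <= qform h v - qform g v + mu * qform y v) ->
      forall v, 0 <= qform h v - qform g v + (mu - kappa * mu ^+ 2) * qform y v.
Proof.
move=> py iw pg ph le_gh mu0 mu00.
have pw := inverse_posdef dot_norm py iw.
have [sS [m m0 hS]] := posdefD ph pg.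
have [[lS [Ks Ks0 bS]] aS] := sS.
have [[lw [Kw Kw0 bw]] aw] := pw.1.
have [[ly [Ky Ky0 by_]] ay] := py.1.
have [[lg [Kg Kg0 bg]] ag] := pg.1.
have [[lh [Kh Kh0 bh]] ah] := ph.1.
(* [K] bounds [P] for every [mu <= mu0], which makes [kappa] independent of [mu]. *)
pose K := Kh + Kg + mu0 * Ky.
have K0 : 0 < K by rewrite /K; nra.
pose C := (Kw * Ks) ^+ 2 * K.
have C0 : 0 < C by rewrite mulr_gt0 // exprn_gt0 // mulr_gt0.
exists (m ^+ 2 / (C * Ky)); first by rewrite divr_gt0 ?exprn_gt0 ?mulr_gt0.
move=> mu mup mule pos v.
pose P := h + (real_complex R (-1) *: g) + (real_complex R mu *: y).
have sP : selfadj dot P by apply: selfadjD; [apply: selfadjD; [exact: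
  ph.1|exact/selfadjZ/pg.1]|exact/selfadjZ/py.1].
have qP u : qform P u = qform h u - qform g u + mu * qform y u by rewrite !qformD
  !qformZ mulN1r.
have PE u : P u = h u - g u + mu *r y u by rewrite /P !opE rmorphN1 scaleN1r.
have bP : opnorm_le P K.
  move=> u; rewrite PE.
  apply: le_trans (ler_nrmD _ _) _; rewrite nrmZ (gtr0_norm mup).
  have := ler_nrmD (h u) (- g u); rewrite nrmN.
  have := bh u; have := bg u; have := by_ u; have := nrm_ge0 u; have := nrm_ge0 (y u).
  rewrite /K => y0 u0 h1 h2 h3 h4.
  have : mu * nrm (y u) <= mu0 * (Ky * nrm u) by apply: ler_pM => //; exact: ltW.
  lra.
have h1 : nrm (P v) ^+ 2 <= K * qform P v.
  by apply: (pos_op_sq dot_norm sP K0 _ bP) => u; rewrite qP.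
set a := nrm (P v) in h1; set n := nrm v.
have n0 : 0 <= n := nrm_ge0 v.
have a0 : 0 <= a := nrm_ge0 _.
have e0 : ip (w (h v - g v)) ((h + g) v) = qform (h \o w \o h) v - qform (g \o w \o g) v.
  rewrite /qform /= opE (linD _ _ lw) (linN _ lw) !ipE ah ag.
  by rewrite (aw (h v) (g v)) (ipC _ (h v) (w (g v))); lra.
have e1 : h v - g v = P v - mu *r y v by rewrite PE addrK.
(* Since [w] inverts [y], the left side of [e0] is [ip (w (P v)) (S v) - mu * ip v (S v)] with
   [S = h + g]; it is nonnegative, so [P v] cannot be small compared with [mu * v]. *)
have h2 : mu * m * n <= Kw * Ks * a.
  have : mu * m * n ^+ 2 <= Kw * Ks * a * n.
    have : 0 <= ip (w (h v - g v)) ((h + g) v) by rewrite e0 subr_ge0; exact: le_gh.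
    rewrite e1 (linD _ _ lw) (linN _ lw) (linZ _ _ lw).
    rewrite (inverseK iw) ipDl ipNl ipZl (ipC _ v) -/(qform (h + g) v) => h2.
    have := hS v => h3; have h4 := cauchy_schwarz dot_norm (w (P v)) ((h + g) v).
    have h5 : nrm (w (P v)) * nrm ((h + g) v) <= (Kw * a) * (Ks * n).
      by apply: ler_pM; rewrite ?nrm_ge0.
    have : mu * (m * n ^+ 2) <= mu * qform (h + g) v by rewrite ler_pM2l.
    lra.
  move: n0; rewrite le_eqVlt => /orP[/eqP <- _|n0].
    by rewrite mulr0 mulr_ge0 // mulr_ge0 // ltW.
  by rewrite expr2 mulrA ler_pM2r.
have h3 : (mu * m) ^+ 2 * n ^+ 2 <= C * qform P v.
  rewrite -exprMn; apply: (@le_trans _ _ ((Kw * Ks * a) ^+ 2)).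
    by rewrite ler_sqr // nnegrE; rewrite ?mulr_ge0 // ltW.
  rewrite exprMn /C -mulrA ler_pM2l // exprn_gt0 // mulr_gt0 //.
have h4 : qform y v <= Ky * n ^+ 2 by apply: qform_ub.
rewrite mulrBl addrA -qP subr_ge0.
have -> : m ^+ 2 / (C * Ky) * mu ^+ 2 * qform y v = ((mu * m) ^+ 2 * qform y v) / (C *
  Ky).
  by rewrite exprMn; ring.
rewrite ler_pdivrMr ?mulr_gt0 //.
have h5 : (mu * m) ^+ 2 * qform y v <= (mu * m) ^+ 2 * (Ky * n ^+ 2).
  by rewrite ler_pM2l // exprn_gt0 // mulr_gt0.
apply: le_trans h5 _.
have : Ky * ((mu * m) ^+ 2 * n ^+ 2) <= Ky * (C * qform P v) by rewrite ler_pM2l.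
lra.
Qed.

(** The [mu] satisfying [Q] form an up-set containing [K / m]. If some [eps > 0] were outside it,
    all its members would exceed [eps], and each step would lower a member by at least
    [kappa * eps ^ 2]; finitely many steps would then reach below [eps]. *)
Lemma riccati_mono y w g h : posdef y -> is_inverse y w -> posdef g -> posdef h ->
  le_op (g \o w \o g) (h \o w \o h) -> le_op g h.
Proof.
move=> py iw pg ph le_gh.
pose Q mu := forall v, 0 <= qform h v - qform g v + mu * qform y v.
have Qup mu nu : mu <= nu -> Q mu -> Q nu.
  move=> le_mu q v; apply: le_trans (q v) _.
  by rewrite lerD2l ler_wpM2r // posdef_ge0.
have [_ [m m0 hy]] := py; have [[[_ [K K0 bg]] _] _] := pg.
pose mu0 := K / m.
have mu00 : 0 < mu0 by rewrite divr_gt0.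
have Qmu0 : Q mu0.
  move=> v; have := posdef_ge0 ph v; have := qform_ub dot_norm v bg; have := hy v.
  move=> h1 h2 h3; have : K * nrm v ^+ 2 <= mu0 * qform y v.
    by rewrite /mu0 -mulrA ler_pM2l // ler_pdivlMl.
  lra.
have [kappa k0 step] := riccati_mono_step py iw pg ph le_gh mu00.
have Qeps eps : 0 < eps -> Q eps.
  move=> eps0; apply: contrapT => nQ.
  have Qk k : Q (mu0 - k%:R * (kappa * eps ^+ 2)).
    elim: k => [|k IH]; first by rewrite mul0r subr0.
    set mu := mu0 - _ in IH.
    have lt_mu : eps < mu by rewrite ltNge; apply/negP => /Qup /(_ IH).
    have ke0 : 0 < kappa * eps ^+ 2 by rewrite mulr_gt0 // exprn_gt0.
    have le_mu : mu <= mu0.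
      by rewrite /mu lerBlDr lerDl mulr_ge0 // ltW.
    apply: Qup (step mu (lt_trans eps0 lt_mu) le_mu IH).
    have : kappa * eps ^+ 2 <= kappa * mu ^+ 2.
      by rewrite ler_pM2l // ler_sqr ?nnegrE ltW // (lt_trans eps0).
    rewrite /mu -[k.+1]addn1 natrD; lra.
  apply: nQ; apply: Qup (Qk (Num.trunc (mu0 / (kappa * eps ^+ 2))).+1).
  have : mu0 / (kappa * eps ^+ 2) < (Num.trunc (mu0 / (kappa * eps ^+ 2))).+1%:R.
    exact: truncnS_gt.
  rewrite ltr_pdivrMr ?mulr_gt0 ?exprn_gt0 //; lra.
move=> v; apply/ler_addgt0Pr => e e0.
have qy := posdef_ge0 py v.
have := Qeps (e / (1 + qform y v)) ; rewrite divr_gt0 ?ltr_pwDl // => /(_ isT v).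
have : e / (1 + qform y v) * qform y v <= e.
  by rewrite -mulrA ler_piMr // ?ltW // mulrC ltr_pdivrMr ?mul1r ?ltrDr ?ltr_pwDl.
lra.
Qed.

(* The geometric mean of [y] and [a] is the positive solution [g] of the      *)
(* Riccati equation [g y^-1 g = a].                                           *)
Definition gmean y a g := exists2 w, is_inverse y w & g \o w \o g = a.

(** The Riccati comparison wants the same middle factor on both sides. Antitonicity of the inverse
    supplies it: [g y^-1 g = a <= b = h z^-1 h <= h y^-1 h]. *)
Lemma gmean_mono y z a b g h : posdef y -> posdef z -> posdef g -> posdef h ->
  gmean y a g -> gmean z b h -> le_op y z -> le_op a b -> le_op g h.
Proof.
move=> py pz pg ph [wy iy ea] [wz iz eb] le_yz le_ab.
apply: (riccati_mono py iy pg ph) => v.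
rewrite ea; apply: le_trans (le_ab v) _; rewrite -eb.
have [_ ah] := ph.1; rewrite /qform /= !ah.
exact: (inverse_antitone py pz iy iz le_yz (h v)).
Qed.

(** Scalars are written as exponentials so that their geometric mean becomes an average of
    exponents: [(s + t) / 2 - s + (s + t) / 2 = t]. *)
Lemma gmeanZ y a g (s t : R) : linear y -> linear g -> gmean y a g ->
  gmean (real_complex R (expR s) *: y) (real_complex R (expR t) *: a)
        (real_complex R (expR ((s + t) / 2)) *: g).
Proof.
move=> ly lg [w iw <-].
have lw : linear w.
  by move=> c u v; apply: (can_inj (inverseK iw)); rewrite ly !(inverseKV iw).
exists (real_complex R (expR (- s)) *: w).
  split; apply/funext => v; rewrite /= !opE.
    rewrite (linZ _ _ ly) scalerA -rmorphM -expRD subrr expR0 scale1r.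
    exact: inverseKV iw v.
  rewrite (linZ _ _ lw) scalerA -rmorphM -expRD addNr expR0 scale1r.
  exact: inverseK iw v.
apply/funext => v; rewrite /= !opE (linZ _ _ lw) !(linZ _ _ lg) !scalerA.
rewrite -!rmorphM -!expRD; by congr (real_complex R (expR _) *: _) => //; field.
Qed.

Lemma gmean_le y z a b g h (s t : R) : posdef y -> posdef z -> posdef g -> posdef h ->
  gmean y a g -> gmean z b h ->
  le_op y (real_complex R (expR s) *: z) -> le_op a (real_complex R (expR t) *: b) ->
  le_op g (real_complex R (expR ((s + t) / 2)) *: h).
Proof.
move=> py pz pg ph gy gz le_yz le_ab.
apply: (gmean_mono py _ pg _ gy (gmeanZ s t pz.1.1.1 ph.1.1.1 gz) le_yz le_ab).
- by apply: posdefZ => //; exact: expR_gt0.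
- by apply: posdefZ => //; exact: expR_gt0.
Qed.

(* The weight of [a] is [2 ^ - m]. *)
Fixpoint wmean m y a g : Prop :=
  if m is m'.+1 then exists h, [/\ posdef h, wmean m' y a h & gmean y h g] else g = a.

Lemma wmean_le m y z a b g h (s t : R) : posdef y -> posdef z -> posdef g -> posdef h ->
  wmean m y a g -> wmean m z b h ->
  le_op y (real_complex R (expR s) *: z) -> le_op a (real_complex R (expR t) *: b) ->
  le_op g (real_complex R (expR ((1 - 2^-1 ^+ m) * s + 2^-1 ^+ m * t)) *: h).
Proof.
move=> py pz; elim: m g h => [|m IH] g h pg ph.
  by move=> -> -> _; rewrite expr0 subrr mul0r add0r mul1r.
move=> [g' [pg' mg' gg]] [h' [ph' mh' gh]] le_yz le_ab.
have := gmean_le py pz pg ph gg gh le_yz (IH _ _ pg' ph' mg' mh' le_yz le_ab).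
by rewrite exprS; congr (le_op _ (real_complex R (expR _) *: _)); field.
Qed.

End GeometricMeans.

(** * Inverses and square roots in the algebra *)

Section Completeness.
Context {R : realType} {E : completeNormedModType R[i]}.

Lemma geometric_small (C d e : R) : 0 <= d -> d < 1 -> 0 < e ->
  exists N, forall n, (N <= n)%N -> C * d ^+ n <= e.
Proof.
move=> d0 d1 e0.
have : (fun n => C * d ^+ n) @ \oo --> (C * 0 : R).
  by apply: cvgMr; apply: cvg_expr; rewrite ger0_norm.
rewrite mulr0 => /cvgrPdist_le /(_ _ e0) [N _ h]; exists N => n /h.
by rewrite sub0r normrN; apply: le_trans; exact: ler_norm.
Qed.

Lemma eq_nrm_small (x y : E) (K : R) :
  (forall e, 0 < e -> nrm (x - y) <= e * K) -> x = y.
Proof.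
move=> h; apply/eqP; rewrite -subr_eq0; apply/eqP/nrm_eq0/eqP.
rewrite eq_le nrm_ge0 andbT; apply/ler_addgt0Pr => e e0; rewrite add0r.
have K1 : 0 < `|K| + 1 by rewrite ltr_wpDl.
apply: le_trans (h (e / (`|K| + 1)) _) _; first exact: divr_gt0.
rewrite -mulrA ler_piMr ?(ltW e0) // mulrC ler_pdivrMr // mul1r.
by have := ler_norm K; lra.
Qed.

Lemma geometric_cvg (u : nat -> E) (C d : R) : 0 <= C -> 0 <= d -> d < 1 ->
  (forall n, nrm (u n.+1 - u n) <= C * d ^+ n) ->
  exists l, forall n, nrm (u n - l) <= C / (1 - d) * d ^+ n.
Proof.
move=> C0 d0 d1 h.
have d1' : 0 < 1 - d by rewrite subr_gt0.
(* Keeping the exact partial sum [1 - d ^ k] of the geometric series is what makes the induction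
   close. *)
have hk n k : nrm (u n - u (n + k)%N) <= C / (1 - d) * (1 - d ^+ k) * d ^+ n.
  elim: k => [|k IH]; first by rewrite addn0 subrr expr0 subrr mulr0 mul0r /nrm normr0.
  rewrite addnS -(subrKA (u (n + k)%N)); apply: le_trans (ler_nrmD _ _) _.
  have := h (n + k)%N; rewrite -nrmN opprB exprD => h1.
  have -> : C / (1 - d) * (1 - d ^+ k.+1) * d ^+ n =
    C / (1 - d) * (1 - d ^+ k) * d ^+ n + C * (d ^+ n * d ^+ k).
    by rewrite exprS; field; rewrite gt_eqF.
  exact: lerD.
have hk' n k : (n <= k)%N -> nrm (u n - u k) <= C / (1 - d) * d ^+ n.
  move=> le_nk; rewrite -(subnKC le_nk); apply: le_trans (hk _ _) _.
  rewrite ler_wpM2r ?exprn_ge0 // ler_piMr ?divr_ge0 ?(ltW d1') //.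
  by rewrite gerBl exprn_ge0.
have /cauchy_cvgP cu : cauchy (u @ \oo).
  apply: cauchy_exP => e e0.
  have e0' : 0 < complex.Re e by move: e0; rewrite ltcE => /andP[].
  (* A positive element of [R[i]] has zero imaginary part. *)
  have ee : e = real_complex R (complex.Re e) by rewrite RRe_real // gtr0_real.
  have e2 : 0 < complex.Re e / 2 by rewrite divr_gt0.
  have [N hN] := geometric_small (C / (1 - d)) d0 d1 e2.
  exists (u N), N => // n /= le_Nn.
  rewrite -ball_normE /= nrmE ee ltcR.
  apply: le_lt_trans (hk' _ _ le_Nn) _.
  apply: le_lt_trans (hN _ (leqnn N)) _; lra.
exists (lim (u @ \oo)) => n.
apply/ler_addgt0Pr => e e0.
have e0' : 0 < real_complex R e by rewrite ltcR.
have /cvgrPdist_le /(_ _ e0') [N _ hN] := cu.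
have {hN} := hN (maxn n N) (leq_maxr _ _).
rewrite nrmE lecR -nrmN opprB => hN.
have := hk' n (maxn n N) (leq_maxl _ _) => hn.
rewrite -(subrKA (u (maxn n N))); apply: le_trans (ler_nrmD _ _) _.
exact: lerD.
Qed.

End Completeness.

(** * Norm limits, inverses and square roots of elements of the algebra *)

Section CstarAlgebra.
Context {R : realType} {E : completeNormedModType R[i]}.
Variable dot : {dot E for (Num.conj : R[i] -> R[i])}.
Hypothesis dot_norm : forall v : E, dot v v = `|v| ^+ 2.
Variable A : set (E -> E).
Hypothesis hA : is_cstar_subalgebra dot A.
Implicit Types S T W : E -> E.
Local Notation "c *r v" := (real_complex R c *: v) (at level 40).
Local Notation ip_inj := (ip_inj dot_norm).
Local Notation qform := (qform dot).
Local Notation posdef := (posdef dot).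
Local Notation selfadj := (selfadj dot).

Lemma cstar_bounded_op T : A T -> bounded_op T.
Proof. by move=> /(cstar_bounded hA) /bounded_op_bounded. Qed.

Lemma cstar_lim (u : nat -> E -> E) T : (forall n, A (u n)) -> bounded_op T ->
  (forall e, 0 < e -> exists N, forall n, (N <= n)%N -> opnorm_le (u n - T) e) -> A T.
Proof.
move=> Au bT h; apply: (cstar_closed hA Au); first exact/bounded_op_bounded.
move=> e e0.
have e0' : 0 < complex.Re e by move: e0; rewrite ltcE => /andP[].
have [N hN] := h _ e0'; exists N => // n /= /hN b v.
have -> : e = real_complex R (complex.Re e) by rewrite RRe_real // gtr0_real.
by rewrite !nrmE -rmorphM lecR; exact: b.
Qed.

(** The pointwise limits are reached at a rate proportional to [nrm v], so the convergence holds in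
    operator norm; linearity and boundedness pass to the limit, and closedness of [A] applies. *)
Lemma operator_geometric_cvg (u : nat -> E -> E) (C d : R) :
  0 <= C -> 0 <= d -> d < 1 -> (forall n, A (u n)) ->
  (forall n, opnorm_le (u n.+1 - u n) (C * d ^+ n)) ->
  exists2 T, A T & forall e, 0 < e -> exists N, forall n, (N <= n)%N -> opnorm_le (u n
    - T) e.
Proof.
move=> C0 d0 d1 Au h.
have /choice [T hT] v : exists l, forall n, nrm (u n v - l) <= C * nrm v / (1 - d) * d
  ^+ n.
  apply: geometric_cvg => //; first by rewrite mulr_ge0 ?nrm_ge0.
  by move=> n; apply: le_trans (h n v) _; rewrite mulrAC.
have cu e : 0 < e -> exists N, forall n, (N <= n)%N -> opnorm_le (u n - T) e.
  move=> e0; have [N hN] := geometric_small (C / (1 - d)) d0 d1 e0.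
  exists N => n /hN le_e v; apply: le_trans (hT v n) _.
  have -> : C * nrm v / (1 - d) * d ^+ n = C / (1 - d) * d ^+ n * nrm v by ring.
  by rewrite ler_wpM2r ?nrm_ge0.
exists T => //; apply: (cstar_lim Au) => //.
split.
  move=> c x y.
  apply: (@eq_nrm_small _ _ _ _ (nrm (c *: x + y) + complex.Re `|c| * nrm x + nrm y))
    => e e0.
  have [N /(_ N (leqnn N)) b] := cu _ e0.
  have [lu _] := cstar_bounded_op (Au N).
  have -> : T (c *: x + y) - (c *: T x + T y) =
    - (u N - T) (c *: x + y) + (c *: (u N - T) x + (u N - T) y).
    rewrite !opE lu scalerBr; move: (c *: u N x) (c *: T x) (u N y) => p q r.
    by apply: ip_inj => w; rewrite !ipE; ring.
  apply: le_trans (ler_nrmD _ _) _; rewrite nrmN !mulrDr -addrA lerD //.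
  apply: le_trans (ler_nrmD _ _) _; rewrite lerD //.
  rewrite nrm_complexZ mulrCA ler_wpM2l //.
  by rewrite -lecR RRe_real ?normr_real ?normr_ge0.
have [N /(_ N (leqnn N)) b] := cu 1 ltr01.
have [lu [M M0 bu]] := cstar_bounded_op (Au N).
exists (M + 1); first by rewrite addr_gt0.
move=> v; have -> : T v = u N v + - (u N - T) v by rewrite !opE opprB addrC subrK.
by apply: le_trans (ler_nrmD _ _) _; rewrite nrmN mulrDl lerD.
Qed.

Lemma lim_opnorm_le (u : nat -> E -> E) T K : (forall n, opnorm_le (u n) K) ->
  (forall e, 0 < e -> exists N, forall n, (N <= n)%N -> opnorm_le (u n - T) e) ->
  opnorm_le T K.
Proof.
move=> bu cu v; apply/ler_addgt0Pr => e e0.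
have n1 : 0 < nrm v + 1 by rewrite ltr_wpDl ?nrm_ge0.
have [N /(_ N (leqnn N)) b] := cu (e / (nrm v + 1)) (divr_gt0 e0 n1).
have -> : T v = u N v + - (u N - T) v by rewrite !opE opprB addrC subrK.
apply: le_trans (ler_nrmD _ _) _; rewrite nrmN; apply: lerD; first exact: bu.
apply: le_trans (b v) _; rewrite -mulrA ler_piMr ?(ltW e0) //.
by rewrite mulrC ler_pdivrMr // mul1r; lra.
Qed.

Lemma lim_selfadj (u : nat -> E -> E) T : (forall n, selfadj (u n)) -> bounded_op T ->
  (forall e, 0 < e -> exists N, forall n, (N <= n)%N -> opnorm_le (u n - T) e) ->
  selfadj T.
Proof.
move=> su bT cu; split=> // x y; apply/eqP; rewrite -subr_eq0 -normr_le0.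
apply/ler_addgt0Pr => e e0; rewrite add0r.
have K1 : 0 < 2 * (nrm x * nrm y) + 1.
  by rewrite ltr_wpDl ?mulr_ge0 ?nrm_ge0.
have [N /(_ N (leqnn N)) b] := cu _ (divr_gt0 e0 K1).
have -> : ip dot (T x) y - ip dot x (T y) = ip dot x ((u N - T) y) - ip dot ((u N - T)
  x) y.
  by rewrite !opE !ipE (su N).2; ring.
have := b x; have := b y; set f := e / _ => by_ bx.
have cs a c : `|ip dot a c| <= nrm a * nrm c.
  rewrite ler_norml cauchy_schwarz // andbT lerNl -ipNl -(nrmN a).
  exact: cauchy_schwarz.
apply: le_trans (ler_normB _ _) _.
apply: le_trans (lerD (cs _ _) (cs _ _)) _.
have f0 : 0 < f by rewrite divr_gt0.
have -> : e = f * (2 * (nrm x * nrm y) + 1) by rewrite /f mulfVK // gt_eqF.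
have := nrm_ge0 x; have := nrm_ge0 y => y0 x0.
have h1 : nrm x * nrm ((u N - T) y) <= nrm x * (f * nrm y) by rewrite ler_wpM2l.
have h2 : nrm ((u N - T) x) * nrm y <= f * nrm x * nrm y by rewrite ler_wpM2r.
lra.
Qed.

(** Common preparation for inverses and square roots. From [m <= T <= K], the operator
    [d = 1 - T / M] with [M = K + m] lies between [0] and [1 - m / M], and its form controls its
    norm. The summand [m] in [M] ensures [m / M < 1]. *)
Lemma posdef_contraction T : A T -> posdef T -> exists M d delta,
  [/\ 0 < M, 0 < delta < 1, A d, selfadj d & opnorm_le d delta /\
      T = real_complex R M *: (id - d)].
Proof.
move=> AT [sT [m m0 hm]]; have [[lT [K K0 bT]] aT] := sT.
pose M := K + m; have M0 : 0 < M by rewrite addr_gt0.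
pose d : E -> E := id + real_complex R (- M^-1) *: T.
have sd : selfadj d by apply: selfadjD; [exact: selfadj_id|exact: selfadjZ].
exists M, d, (1 - m / M).
have mM : m / M < 1 by rewrite ltr_pdivrMr // mul1r /M ltrDr.
have d0 : 0 < 1 - m / M by rewrite subr_gt0.
split=> //.
- by rewrite d0 /= gtrBl divr_gt0.
- by apply: (cstar_add hA); [exact: (cstar_one hA)|exact: (cstar_scale hA)].
split.
  apply: opnorm_le_qform => // v.
  have -> : qform d v = nrm v ^+ 2 - M^-1 * qform T v by rewrite qformD qformZ /qform
    ipvv // mulNr.
  have h1 := hm v; have h2 := qform_ub dot_norm v bT.
  have h3 : M^-1 * qform T v <= nrm v ^+ 2.
    rewrite ler_pdivrMl // /M mulrDl; have := sqr_ge0 (nrm v); nra.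
  have h4 : m / M * nrm v ^+ 2 <= M^-1 * qform T v.
    have -> : m / M * nrm v ^+ 2 = M^-1 * (m * nrm v ^+ 2) by ring.
    by rewrite ler_pM2l ?invr_gt0.
  by rewrite ger0_norm ?subr_ge0 // mulrBl mul1r; lra.
apply/funext => v; rewrite !opE /d !opE opprD addrA subrr sub0r.
rewrite rmorphN scaleNr opprK scalerA -rmorphM mulfV ?gt_eqF // scale1r //.
Qed.

Lemma cstar0 : A 0.
Proof. by have := cstar_scale hA 0 (cstar_one hA); rewrite scale0r. Qed.

Lemma cstarB S T : A S -> A T -> A (S - T).
Proof.
by move=> AS AT; rewrite -(scaleN1r T); apply: (cstar_add hA) => //; exact:
  (cstar_scale hA).
Qed.

Lemma selfadj0 : selfadj (0 : E -> E).
Proof. by have := selfadjZ 0 (selfadj_id dot); rewrite rmorph0 scale0r. Qed.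

Lemma selfadjB S T : selfadj S -> selfadj T -> selfadj (S - T).
Proof.
move=> sS sT; have -> : S - T = S + real_complex R (-1) *: T.
  by rewrite rmorphN1 scaleN1r.
by apply: selfadjD => //; exact: selfadjZ.
Qed.

(* Neumann series. *)
Lemma cstar_inverse T : A T -> posdef T -> exists W, [/\ A W, posdef W & is_inverse T W].
Proof.
move=> AT pT; have [M [d [D [M0 /andP[D0 D1] Ad sd [bd eT]]]]] := posdef_contraction AT
  pT.
have [ld _] := sd.1.
pose u := fix u n : E -> E := if n is m.+1 then id + (d \o u m) else id.
have Au n : A (u n).
  elim: n => [|n IH] /=; first exact: (cstar_one hA).
  by apply: (cstar_add hA); [exact: (cstar_one hA)|exact: (cstar_mul hA)].
have bu n : opnorm_le (u n.+1 - u n) (D * D ^+ n).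
  elim: n => [|n IH] v.
    by rewrite !opE /= addrC addrA addNr add0r expr0 mulr1.
  have -> : (u n.+2 - u n.+1) v = d ((u n.+1 - u n) v).
    rewrite [in RHS]opE [in RHS]opNE (linD _ _ ld) (linN _ ld) !opE /= !opE /=.
    by apply: ip_inj => w; rewrite !ipE; ring.
  apply: le_trans (bd _) _; rewrite exprS -!mulrA ler_pM2l // mulrA.
  exact: IH.
have [W AW cW] := operator_geometric_cvg (ltW D0) (ltW D0) D1 Au bu.
have eW v : W v = v + d (W v).
  apply: (@eq_nrm_small _ _ _ _ (2 * nrm v)) => e e0.
  have [N hN] := cW _ e0.
  have -> : W v - (v + d (W v)) = - (u N.+1 - W) v + d ((u N - W) v).
    rewrite !opE (linD _ _ ld) (linN _ ld) /= !opE /=.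
    by apply: ip_inj => w; rewrite !ipE; ring.
  apply: le_trans (ler_nrmD _ _) _; rewrite nrmN.
  have h1 := hN N.+1 (leqnSn N) v; have h2 := bd ((u N - W) v); have h3 := hN N (leqnn
    N) v.
  have := nrm_ge0 ((u N - W) v); nra.
have AW' : A (real_complex R M^-1 *: W) by exact: (cstar_scale hA).
have [lT _] := pT.1.1.
have iW v : T ((real_complex R M^-1 *: W) v) = v.
  rewrite opE (linZ _ _ lT) eT !opE scalerA -rmorphM mulVf ?gt_eqF // scale1r.
  by rewrite {1}eW addrK.
have iT : is_inverse T (real_complex R M^-1 *: W).
  split; apply/funext => v; first exact: iW.
  (* The series yields a right inverse; [T] is bounded below, hence injective, so it is a left
     inverse too. *)
  have [m m0 hm] := posdef_lower_bound dot_norm pT.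
  apply: (@eq_nrm_small _ _ _ _ 0) => e e0; rewrite mulr0 /=.
  have := hm ((real_complex R M^-1 *: W) (T v) - v).
  rewrite (linD _ _ lT) (linN _ lT) iW subrr /nrm normr0 /= pmulr_rle0 //.
by exists (real_complex R M^-1 *: W); split => //; apply: inverse_posdef iT.
Qed.

(* With [T = M (1 - d)], the square root is [sqrt M (1 - z)] for the fixed    *)
(* point [z] of the contraction [z |-> (d + z ^ 2) / 2].                      *)
Lemma cstar_sqrt T : A T -> posdef T -> exists S, [/\ A S, posdef S & S \o S = T].
Proof.
move=> AT pT; have [M [d [D [M0 /andP[D0 D1] Ad sd [bd eT]]]]] := posdef_contraction AT
  pT.
pose u := fix u n : E -> E :=
  if n is m.+1 then real_complex R 2^-1 *: (d + (u m \o u m)) else 0.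
(* The ball of radius [D] is stable because [(D + D ^ 2) / 2 <= D]. *)
have hu n : [/\ A (u n), selfadj (u n) & opnorm_le (u n) D].
  elim: n => [|n [IH1 IH2 IH3]] /=.
    split; [exact: cstar0|exact: selfadj0|move=> v].
    by rewrite /nrm normr0 mulr_ge0 ?nrm_ge0 // ltW.
  split.
  - by apply: (cstar_scale hA); apply: (cstar_add hA) => //; exact: (cstar_mul hA).
  - by apply: selfadjZ; apply: selfadjD => //; exact: (selfadjX 2 IH2).
  - move=> v; rewrite !opE nrmZ gtr0_norm ?invr_gt0 //.
    have := ler_nrmD (d v) (u n (u n v)); have := bd v.
    have := IH3 (u n v); have := IH3 v; rewrite /=.
    have := nrm_ge0 (u n v); have := nrm_ge0 v; nra.
have bu n : opnorm_le (u n.+1 - u n) (D * D ^+ n).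
  elim: n => [|n IH] v.
    rewrite !opE /= !opE subr0 addr0 nrmZ gtr0_norm ?invr_gt0 // expr0 mulr1.
    have := bd v; have := nrm_ge0 (d v); lra.
  have [_ [[l1 _] _] b1] := hu n.+1; have [_ [[l0 _] _] b0] := hu n.
  (* The identity [p p - q q = p (p - q) + (p - q) q] requires no commutation; each term gains a
     factor [D], and [2^-1] averages the two. *)
  have -> : (u n.+2 - u n.+1) v =
      2^-1 *r (u n.+1 ((u n.+1 - u n) v) + (u n.+1 - u n) (u n v)).
    have -> : u n.+2 = real_complex R 2^-1 *: (d + (u n.+1 \o u n.+1)) by [].
    rewrite !opE (linD _ _ l1) (linN _ l1) subrKA.
    have -> : u n.+1 v = 2^-1 *r (d v + u n (u n v)) by [].
    by apply: ip_inj => w; rewrite !ipE; ring.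
  rewrite nrmZ gtr0_norm ?invr_gt0 //.
  have := ler_nrmD (u n.+1 ((u n.+1 - u n) v)) ((u n.+1 - u n) (u n v)).
  have h1 := b1 ((u n.+1 - u n) v); have h2 := IH v; have h3 := IH (u n v); have h4 :=
    b0 v.
  have k0 : 0 < D * D ^+ n by rewrite mulr_gt0 // exprn_gt0.
  have h5 : D * nrm ((u n.+1 - u n) v) <= D * (D * D ^+ n * nrm v) by rewrite ler_pM2l.
  have h6 : D * D ^+ n * nrm (u n v) <= D * D ^+ n * (D * nrm v) by rewrite ler_pM2l.
  rewrite exprS; lra.
have [z Az cz] := operator_geometric_cvg (ltW D0) (ltW D0) D1 (fun n => let: And3 h _ _
  := hu n in h) bu.
have bz : opnorm_le z D by apply: lim_opnorm_le cz => n; have [] := hu n.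
have sz : selfadj z.
  by apply: lim_selfadj cz => [n|]; [have [] := hu n|exact: cstar_bounded_op].
have [[lz _] _] := sz.
have ez v : z v = 2^-1 *r (d v + z (z v)).
  apply: (@eq_nrm_small _ _ _ _ (2 * nrm v)) => e e0.
  have [N hN] := cz _ e0; have [_ [[l0 _] _] b0] := hu N.
  have -> : z v - 2^-1 *r (d v + z (z v)) =
     - (u N.+1 - z) v + 2^-1 *r (u N ((u N - z) v) + (u N - z) (z v)).
    have -> : u N.+1 = real_complex R 2^-1 *: (d + (u N \o u N)) by [].
    rewrite !opE /= (linD _ _ l0) (linN _ l0).
    by apply: ip_inj => w; rewrite !ipE; ring.
  apply: le_trans (ler_nrmD _ _) _; rewrite nrmN nrmZ gtr0_norm ?invr_gt0 //.
  have h1 := hN N.+1 (leqnSn N) v; have h2 := hN N (leqnn N) v.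
  have h3 := hN N (leqnn N) (z v); have h4 := b0 ((u N - z) v); have h5 := bz v.
  have h6 := ler_nrmD (u N ((u N - z) v)) ((u N - z) (z v)).
  have := nrm_ge0 ((u N - z) v); have := nrm_ge0 v => n0 n1.
  have h7 : e * nrm (z v) <= e * nrm v.
    by rewrite ler_pM2l //; apply: le_trans h5 _; rewrite ler_piMl // ltW.
  have h8 : D * nrm ((u N - z) v) <= nrm ((u N - z) v) by rewrite ler_piMl // ltW.
  lra.
pose q := Num.sqrt M; have q0 : 0 < q by rewrite sqrtr_gt0.
have As : A (real_complex R q *: (id - z)).
  by apply: (cstar_scale hA); apply: cstarB => //; exact: (cstar_one hA).
have ss : selfadj (real_complex R q *: (id - z)).
  by apply: selfadjZ; apply: selfadjB => //; exact: selfadj_id.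
exists (real_complex R q *: (id - z)); split => //.
  split=> //; exists (q * (1 - D)); first by rewrite mulr_gt0 // subr_gt0.
  move=> v; rewrite qformZ -mulrA ler_pM2l // /qform !opE !ipE ipvv //.
  have := qform_ub dot_norm v bz; rewrite /qform; lra.
apply/funext => v; rewrite /= eT !opE.
rewrite (linZ _ _ lz) (linD _ _ lz) (linN _ lz).
apply: ip_inj => w; have := congr1 (ip dot ^~ w) (ez v).
rewrite !ipE => e; have eM : q * q = M by rewrite -expr2 sqr_sqrtr // ltW.
by rewrite -eM e; field.
Qed.

End CstarAlgebra.

(** * Euler's formula for the exponential *)

Section EulerExponential.
Context {R : realType} {E : completeNormedModType R[i]}.
Implicit Types l u : E -> E.

Lemma lin_sum l I (r : seq I) (P : pred I) (F : I -> E) : linear l ->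
  l (\sum_(i <- r | P i) F i) = \sum_(i <- r | P i) l (F i).
Proof.
by move=> ll; apply: (big_morph l) => [x y|]; [exact: linD|exact: lin0].
Qed.

Lemma ler_nrm_sum I (r : seq I) (P : pred I) (F : I -> E) :
  nrm (\sum_(i <- r | P i) F i) <= \sum_(i <- r | P i) nrm (F i).
Proof.
elim/big_ind2: _ => //; first by rewrite /nrm normr0.
by move=> x a y b h1 h2; apply: le_trans (ler_nrmD _ _) _; exact: lerD.
Qed.

Lemma iter_id_addE l (c : R[i]) N v : linear l ->
  iter N (id + c *: l) v = \sum_(k < N.+1) ('C(N, k)%:R * c ^+ k) *: iter k l v.
Proof.
move=> ll; elim: N => [|N IH].
  by rewrite big_ord_recl big_ord0 /= bin0 expr0 mulr1 scale1r addr0.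
rewrite iterS IH; set s := \sum_(k < N.+1) _.
have -> : (id + c *: l) s = s + c *: l s by [].
have -> : c *: l s = \sum_(k < N.+1) ('C(N, k)%:R * c ^+ k.+1) *: iter k.+1 l v.
  rewrite /s lin_sum // scaler_sumr; apply: eq_bigr => k _.
  by rewrite (linZ _ _ ll) scalerA exprS; congr (_ *: _); ring.
have -> : s = v + \sum_(k < N.+1) ('C(N, k.+1)%:R * c ^+ k.+1) *: iter k.+1 l v.
  rewrite /s big_ord_recl [nat_of_ord ord0]/= bin0 expr0 mulr1 scale1r; congr (_ + _).
  by rewrite big_ord_recr /= bin_small // mul0r scale0r addr0.
rewrite -addrA -big_split [RHS]big_ord_recl [nat_of_ord ord0]/= bin0 expr0 mulr1
  scale1r; congr (_ + _).
by apply: eq_bigr => k _; rewrite /= -scalerDl -mulrDl -natrD /bump /= add1n binS addnC.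
Qed.

Lemma ffact_leq_exp n m : (n ^_ m <= n ^ m)%N.
Proof.
elim: m => [|m IH]; first by rewrite ffactn0.
by rewrite ffactnSr expnSr leq_mul // leq_subr.
Qed.

(** ['C(N, k) * k!] is a falling factorial, at most [N ^ k]. Thus the exponential series minus
    [(1 + x / N) ^ N] has nonnegative coefficients, which is what allows an operator to be replaced
    by its norm bound. *)
Lemma bin_le_invfact N k : (0 < N)%N -> 'C(N, k)%:R * N%:R^-1 ^+ k <= (k`!%:R)^-1 :> R.
Proof.
move=> N0; have f0 : 0 < k`!%:R :> R by rewrite ltr0n fact_gt0.
have Nk : 0 < N%:R ^+ k :> R by rewrite exprn_gt0 // ltr0n.
rewrite exprVn ler_pdivrMr // ler_pdivlMl // -natrX -natrM ler_nat mulnC bin_ffact.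
exact: ffact_leq_exp.
Qed.

Lemma exp_partial_sum_le (M : R) N : 0 <= M ->
  \sum_(k < N) (k`!%:R)^-1 * M ^+ k <= expR M.
Proof.
move=> M0.
have -> : \sum_(k < N) (k`!%:R)^-1 * M ^+ k = series (exp_coeff M) N.
  by rewrite /series /= big_mkord; apply: eq_bigr => k _; rewrite /exp_coeff /= mulrC.
apply: nondecreasing_cvgn_le; last exact: is_cvg_series_exp_coeff.
apply/nondecreasing_seqP => n; rewrite /series /= big_nat_recr //= lerDl.
by rewrite /exp_coeff /= divr_ge0 ?exprn_ge0.
Qed.

(** With [x = M / N], the bound [expR (x / (1 + x)) <= 1 + x] is raised to the power [N]; then [N *
    x / (1 + x) >= N * x * (1 - x) = M - M ^ 2 / N]. *)
Lemma euler_power_ge (M : R) N : 0 <= M -> (0 < N)%N ->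
  expR M * (1 - M ^+ 2 / N%:R) <= (1 + M / N%:R) ^+ N.
Proof.
move=> M0 N0; have Np : 0 < N%:R :> R by rewrite ltr0n.
set x := M / N%:R; have x0 : 0 <= x by rewrite divr_ge0 // ltW.
have x1 : 0 < 1 + x by lra.
have h1 : expR (x / (1 + x)) <= 1 + x.
  rewrite -[leRHS]invrK -[leLHS]invrK lef_pV2 ?posrE ?invr_gt0 ?expR_gt0 //.
  rewrite -expRN; apply: le_trans (expR_ge1Dx _).
  have -> : 1 + - (x / (1 + x)) = (1 + x)^-1; last by [].
  by field; rewrite gt_eqF.
have h2 : expR (x / (1 + x)) ^+ N <= (1 + x) ^+ N.
  by apply: lerXn2r; rewrite ?nnegrE ?expR_ge0 // ltW.
apply: le_trans h2; rewrite -expRM_natl.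
apply: (@le_trans _ _ (expR M * expR (- (M ^+ 2 / N%:R)))).
  by rewrite ler_pM2l ?expR_gt0 // expR_ge1Dx.
rewrite -expRD ler_expR.
have -> : M - M ^+ 2 / N%:R = N%:R * (x * (1 - x)).
  by rewrite /x; field; rewrite gt_eqF.
rewrite ler_pM2l // ler_wpM2l // -div1r ler_pdivlMr //.
have := sqr_ge0 x; lra.
Qed.

(** Both terms are polynomials of degree [N] in [l], whence the [N.+1] summands. Their difference
    has nonnegative coefficients, so its norm is at most its value at the scalar [M]. *)
Lemma exp_sum_euler l (M : R) N : linear l -> 0 <= M -> opnorm_le l M -> (0 < N)%N ->
  opnorm_le (\sum_(k < N.+1) (k`!%:R : R[i])^-1 *: (iter k l : E -> E)
         - iter N (id + real_complex R N%:R^-1 *: l)) (expR M * (M ^+ 2 / N%:R)).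
Proof.
move=> ll M0 bl N0 v.
pose d k : R := (k`!%:R)^-1 - 'C(N, k)%:R * N%:R^-1 ^+ k.
have d0 k : 0 <= d k by rewrite subr_ge0 bin_le_invfact.
have bl_iter k : nrm (iter k l v) <= M ^+ k * nrm v.
  elim: k => [|k IH]; first by rewrite expr0 mul1r.
  rewrite iterS; apply: le_trans (bl _) _.
  by rewrite exprS -mulrA ler_wpM2l.
rewrite opDE opNE fct_sumE iter_id_addE // -sumrB.
have -> : \sum_(k < N.+1) (((k`!%:R : R[i])^-1 *: (iter k l : E -> E)) v
      - ('C(N, k)%:R * real_complex R N%:R^-1 ^+ k) *: iter k l v) =
    \sum_(k < N.+1) real_complex R (d k) *: iter k l v.
  apply: eq_bigr => k _; rewrite opZE -scalerBl /d; congr (_ *: _).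
  by rewrite rmorphB rmorphM !fmorphV rmorphXn !fmorphV !rmorph_nat.
apply: le_trans (ler_nrm_sum _ _ _) _.
apply: (@le_trans _ _ ((\sum_(k < N.+1) d k * M ^+ k) * nrm v)).
  rewrite mulr_suml; apply: ler_sum => k _.
  by rewrite nrmZ ger0_norm ?d0 // -mulrA ler_wpM2l ?d0 ?bl_iter.
rewrite ler_wpM2r ?nrm_ge0 //.
have -> : \sum_(k < N.+1) d k * M ^+ k =
    \sum_(k < N.+1) (k`!%:R)^-1 * M ^+ k - (1 + M / N%:R) ^+ N.
  rewrite exprDn -sumrB; apply: eq_bigr => k _.
  by rewrite /d mulrBl expr1n mul1r exprMn -mulr_natl; ring.
have := exp_partial_sum_le N.+1 M0; have := euler_power_ge M0 N0; lra.
Qed.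

Lemma exp_euler l u : bounded_op l -> is_exp l u -> forall e : R, 0 < e ->
  exists N0, forall N, (N0 <= N)%N ->
    opnorm_le (u - iter N (id + real_complex R N%:R^-1 *: l)) e.
Proof.
move=> [ll [M M0 bl]] hu e e0.
have e2 : 0 < real_complex R (e / 2) by rewrite ltcR divr_gt0.
have [N1 _ h1] := hu _ e2.
pose N2 := (Num.trunc (expR M * M ^+ 2 / (e / 2))).+1.
exists (maxn N1 N2) => N; rewrite geq_max => /andP[le1 le2] v.
have N0 : (0 < N)%N by apply: leq_trans le2.
have := h1 N.+1 (leqW le1) v; rewrite !nrmE -rmorphM lecR -nrmN opprB => h3.
have h4 := exp_sum_euler ll (ltW M0) bl N0 v.
set s := \sum_(k < N.+1) _ in h3 h4; set p := iter N _ in h4 *.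
have -> : (u - p) v = (u v - s v) + (s - p) v by rewrite !opE addrA subrK.
apply: le_trans (ler_nrmD _ _) _.
have h5 : expR M * (M ^+ 2 / N%:R) <= e / 2.
  have lt2 : expR M * M ^+ 2 / (e / 2) < N2%:R := truncnS_gt _.
  have le3 : N2%:R <= N%:R :> R by rewrite ler_nat.
  have := le_trans (ltW lt2) le3.
  rewrite (ler_pdivrMr _ _ (divr_gt0 e0 _)) // => h6.
  by rewrite mulrA ler_pdivrMr ?ltr0n // [leRHS]mulrC.
have := nrm_ge0 v; nra.
Qed.

End EulerExponential.

(** * Karcher mean *)

Section KarcherMean.
Context {R : realType} {E : completeNormedModType R[i]}.
Variable dot : {dot E for (Num.conj : R[i] -> R[i])}.
Hypothesis dot_norm : forall v : E, dot v v = `|v| ^+ 2.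
Variable A : set (E -> E).
Hypothesis hA : is_cstar_subalgebra dot A.
Implicit Types S T y a g : E -> E.
Local Notation ip := (ip dot).
Local Notation qform := (qform dot).
Local Notation posdef := (posdef dot).
Local Notation selfadj := (selfadj dot).
Local Notation le_op := (le_op dot).
Local Notation wmean := (wmean dot).

Lemma positive_selfadj (B : set (E -> E)) S : B `<=` bounded_operators ->
  positive dot B S -> selfadj S /\ forall v, 0 <= qform S v.
Proof.
move=> sB [b [c [Bb Bc adj ->]]].
have h u v : ip (c (b u)) v = ip (b u) (b v).
  by rewrite (ipC _ (c _)) -(ip_adjoint adj) ipC.
split; last by move=> v; rewrite /qform /= h ipvv // sqr_ge0.
split; first by apply: bounded_op_comp; apply/bounded_op_bounded; exact: sB.
by move=> u v; rewrite /= h (ip_adjoint adj).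
Qed.

(** The bound [K] of the inverse gives [nrm v <= K * nrm (S v)], and positivity gives
    [nrm (S v) ^ 2 <= M * qform S v]. *)
Lemma pos_cone_posdef (B : set (E -> E)) S : B `<=` bounded_operators ->
  pos_cone dot B S -> posdef S.
Proof.
move=> sB [pS [BS [T BT iT]]].
have [sS S0] := positive_selfadj sB pS.
have [_ [M M0 bM]] := sS.1.
have [_ [K K0 bK]] : bounded_op T by apply/bounded_op_bounded; exact: sB.
split=> //; exists (K ^+ 2 * M)^-1; first by rewrite invr_gt0 mulr_gt0 // exprn_gt0.
move=> v; rewrite ler_pdivrMl ?mulr_gt0 ?exprn_gt0 // -mulrA.
apply: (@le_trans _ _ (K ^+ 2 * nrm (S v) ^+ 2)).
  rewrite -exprMn ler_sqr ?nnegrE ?mulr_ge0 ?nrm_ge0 ?(ltW K0) //.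
  by have := bK (S v); rewrite (inverseK iT).
by rewrite ler_pM2l ?exprn_gt0 //; exact: pos_op_sq.
Qed.

(** A form of spectral permanence: the square root that witnesses positivity and the inverse are
    both found inside [A]. *)
Lemma posdef_pos_cone S : A S -> posdef S -> pos_cone dot A S.
Proof.
move=> AS pS; split; last first.
  by split=> //; have [W [AW _ iW]] := cstar_inverse dot_norm hA AS pS; exists W.
have [r [Ar pr <-]] := cstar_sqrt dot_norm hA AS pS; exists r, r; split=> //.
by apply: adjoint_ip => //; [exact: pr.1.1.1|exact: pr.1.1.1|exact: pr.1.2].
Qed.

(** The witness is the classical formula [y^(1/2) (y^(-1/2) a y^(-1/2))^(1/2) y^(1/2)], with
    [s = y^(1/2)] and [k] the middle root. *)
Lemma cstar_gmean y a : A y -> posdef y -> A a -> posdef a ->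
  exists g, [/\ A g, posdef g & gmean y a g].
Proof.
move=> Ay py Aa pa.
have [s [As ps <-]] := cstar_sqrt dot_norm hA Ay py.
have [si [Asi psi isi]] := cstar_inverse dot_norm hA As ps.
have [m m0 hm] := posdef_lower_bound dot_norm psi.
have [n n0 hn] := posdef_lower_bound dot_norm ps.
have [k [Ak pk ek]] : exists k, [/\ A k, posdef k & k \o k = si \o a \o si].
  apply: (cstar_sqrt dot_norm hA); last exact: (posdef_conj psi.1 m0 hm pa).
  by apply: (cstar_mul hA) => //; exact: (cstar_mul hA).
exists (s \o k \o s); split.
- by apply: (cstar_mul hA) => //; exact: (cstar_mul hA).
- exact: (posdef_conj ps.1 n0 hn pk).
exists (si \o si).
  split; apply/funext => v /=; first by rewrite !(inverseKV isi).
  by rewrite !(inverseK isi).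
apply/funext => v /=; rewrite (inverseK isi) (inverseKV isi).
have /= -> := congr1 (fun f => f (s v)) ek.
by rewrite (inverseK isi) (inverseKV isi).
Qed.

Lemma cstar_wmean m y a : A y -> posdef y -> A a -> posdef a ->
  exists g, [/\ A g, posdef g & wmean m y a g].
Proof.
move=> Ay py Aa pa; elim: m => [|m [h [Ah ph mh]]]; first by exists a.
have [g [Ag pg gg]] := cstar_gmean Ay py Ah ph.
by exists g; split=> //; exists h.
Qed.

Lemma cstar_norm_closed T : bounded_op T ->
  (forall e : R, 0 < e -> exists2 y, A y & opnorm_le (y - T) e) -> A T.
Proof.
move=> bT h.
have hn (n : nat) : exists y, A y /\ opnorm_le (y - T) (n.+1%:R^-1).
  by have [|y Ay b] := h (n.+1%:R^-1); [rewrite invr_gt0 | exists y].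
have /choice [u hu] := hn.
apply: (cstar_lim hA (u := u)) => // [n|e e0]; first by have [] := hu n.
exists (Num.trunc e^-1) => n le_n v; have [_ b] := hu n.
apply: le_trans (b v) _; rewrite ler_wpM2r ?nrm_ge0 //.
rewrite -[leRHS]invrK lef_pV2 ?posrE ?invr_gt0 //.
apply: ltW; apply: lt_le_trans (truncnS_gt _) _.
by rewrite ler_nat.
Qed.

(** Since [u >= mu], an additive error [mu * d] in Euler's formula is a relative error [d], which a
    factor [expR eps] absorbs. Validity for all large [m] allows one [m] for all indices. *)
Lemma log_approx l u (eps : R) : posdef u -> selfadj l -> is_exp l u -> 0 < eps ->
  exists m0, forall m, (m0 <= m)%N ->
    let p := id + real_complex R (2 ^ m)%:R^-1 *: l in
    [/\ posdef p, le_op u (real_complex R (expR eps) *: iter (2 ^ m) p)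
      & le_op (iter (2 ^ m) p) (real_complex R (expR eps) *: u)].
Proof.
move=> pu sl hexp eps0; have [_ [mu mu0 hu]] := pu.
(* [2 * d <= eps] gives [1 + 2 * d <= expR eps], and [2 * d <= 1] gives
   [(1 - d) * (1 + 2 * d) >= 1]. *)
pose d := Num.min eps 1 / 2.
have d0 : 0 < d by rewrite divr_gt0 // lt_min eps0 ltr01.
have d1 : 2 * d <= 1 by rewrite /d mulrC divfK // ge_min lexx orbT.
have d2 : 2 * d <= eps by rewrite /d mulrC divfK // ge_min lexx.
have [N0 hN] := exp_euler sl.1 hexp (mulr_gt0 mu0 d0).
have [_ [L L0 bL]] := sl.1.
(* Ensures [2 * L <= 2 ^ m], hence [p >= 1 / 2]. *)
pose N1 := (Num.trunc (2 * L)).+1.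
exists (maxn N0 N1) => m le_m p.
have lt2m : (m < 2 ^ m)%N by apply: ltn_expl.
have le0 : (N0 <= 2 ^ m)%N.
  by apply: leq_trans (ltnW lt2m); apply: leq_trans le_m; exact: leq_maxl.
have le1 : (N1 <= 2 ^ m)%N.
  by apply: leq_trans (ltnW lt2m); apply: leq_trans le_m; exact: leq_maxr.
have hL : 2 * L <= (2 ^ m)%:R.
  by apply: ltW; apply: lt_le_trans (truncnS_gt _) _; rewrite ler_nat.
have Np : 0 < (2 ^ m)%:R :> R by rewrite ltr0n expn_gt0.
have hb := hN _ le0; rewrite -/p in hb.
have h1 v : qform u v <= qform (iter (2 ^ m) p) v + d * qform u v.
  have := qform_diff_ub dot_norm v hb; have := hu v => h2 h3.
  have : d * (mu * nrm v ^+ 2) <= d * qform u v by rewrite ler_pM2l.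
  lra.
have h2 v : qform (iter (2 ^ m) p) v <= qform u v + d * qform u v.
  have hb' w : nrm (iter (2 ^ m) p w - u w) <= mu * d * nrm w.
    by rewrite -nrmN opprB; exact: hb.
  have := qform_diff_ub dot_norm v hb'; have := hu v => h2 h3.
  have : d * (mu * nrm v ^+ 2) <= d * qform u v by rewrite ler_pM2l.
  lra.
have le_exp : 1 + 2 * d <= expR eps.
  by apply: le_trans (expR_ge1Dx eps); rewrite lerD2l.
split.
- split; first by apply: selfadjD; [exact: selfadj_id|exact: selfadjZ].
  exists 2^-1 => // v; rewrite qformD qformZ /qform ipvv //.
  have bLN : opnorm_le (- l) L by move=> w; rewrite opNE nrmN.
  have := qform_ub dot_norm v bLN; rewrite /qform opNE ipNl => h3.
  have : (2 ^ m)%:R^-1 * (- ip (l v) v) <= 2^-1 * nrm v ^+ 2.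
    rewrite ler_pdivrMl //; apply: le_trans h3 _.
    by have := sqr_ge0 (nrm v); nra.
  lra.
- move=> v; rewrite qformZ; have := h1 v; have := posdef_ge0 pu v.
  set b := qform u v; set c := qform (iter _ _) v => b0 h3.
  have c0 : 0 <= c by nra.
  have : (1 + 2 * d) * c <= expR eps * c by rewrite ler_wpM2r.
  have : 0 <= d * b * (1 - 2 * d) by apply: mulr_ge0; [apply: mulr_ge0 => //; exact:
    ltW|rewrite subr_ge0].
  have : 0 <= (1 + 2 * d) * (c + d * b - b).
    by apply: mulr_ge0; [lra|rewrite subr_ge0].
  lra.
- move=> v; rewrite qformZ; have := h2 v; have := posdef_ge0 pu v.
  set b := qform u v; set c := qform (iter _ _) v => b0 h3.
  have : (1 + 2 * d) * b <= expR eps * b by rewrite ler_wpM2r.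
  nra.
Qed.

(** [(r q r) (r r)^-1 (r q r) = r q q r]: each mean with [r r] undoes one squaring, so [m] of them
    reduce the power [2 ^ m] to [q]. *)
Lemma wmean_conj m r s q k : selfadj r -> 0 < k -> (forall v, k * nrm v <= nrm (r v)) ->
  is_inverse r s -> posdef q ->
  wmean m (r \o r) (r \o iter (2 ^ m) q \o r) (r \o q \o r).
Proof.
move=> sr k0 hr irs; elim: m q => [|m IH] q pq //.
have [c c0 hc] := posdef_lower_bound dot_norm pq.
have pqq := posdef_sqr dot_norm pq.1 c0 hc.
exists (r \o (q \o q) \o r); split; first exact: (posdef_conj sr k0 hr).
  have -> : iter (2 ^ m.+1) q = iter (2 ^ m) (q \o q).
    by apply/funext => v; rewrite expnSr iterM.
  exact: IH.
exists (s \o s).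
  split; apply/funext => v /=; first by rewrite !(inverseKV irs).
  by rewrite !(inverseK irs).
by apply/funext => v /=; rewrite (inverseK irs) (inverseKV irs).
Qed.

Lemma qform_sum n (F : 'I_n -> E -> E) v :
  qform (\sum_(i < n) F i) v = \sum_(i < n) qform (F i) v.
Proof. by rewrite /qform fct_sumE ipC ip_sumr; apply: eq_bigr => i _; rewrite ipC. Qed.

Lemma cstar_sum n (F : 'I_n -> E -> E) : (forall i, A (F i)) -> A (\sum_(i < n) F i).
Proof.
move=> h; elim/big_ind: _ => //; first exact: cstar0 hA.
exact: (cstar_add hA).
Qed.

Lemma posdef_sum n (F : 'I_n -> E -> E) : (0 < n)%N -> (forall i, posdef (F i)) ->
  posdef (\sum_(i < n) F i).
Proof.
case: n F => // n F _; elim: n F => [|n IH] F h; first by rewrite big_ord1.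
by rewrite big_ord_recr; apply: posdefD => //; apply: IH.
Qed.

Lemma qform_conj r S v : selfadj r -> qform (r \o S \o r) v = qform S (r v).
Proof. by move=> sr; rewrite /qform /= sr.2. Qed.

(** Thompson distance at most [t], expressed by the order alone so that no infimum is taken. *)
Definition thompson_le S T (t : R) :=
  le_op S (real_complex R (expR t) *: T) /\ le_op T (real_complex R (expR t) *: S).

Lemma thompson_leW S T s t : posdef S -> posdef T -> s <= t ->
  thompson_le S T s -> thompson_le S T t.
Proof.
move=> pS pT st [h1 h2]; split=> v; [apply: le_trans (h1 v) _|apply: le_trans (h2 v) _];
  by rewrite !qformZ ler_wpM2r ?ler_expR // posdef_ge0.
Qed.

(** * Approximating a Karcher solution from inside the algebra *)

Section Iteration.
Variables (n : nat) (n_gt0 : (0 < n)%N) (a l : 'I_n -> E -> E) (r s : E -> E) (k : R).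
Hypotheses (Aa : forall i, A (a i)) (pa : forall i, posdef (a i)).
Hypotheses (sr : selfadj r) (k0 : 0 < k) (hr : forall v, k * nrm v <= nrm (r v)).
Hypotheses (irs : is_inverse r s) (sl : forall i, selfadj (l i)).
Hypotheses (hl : forall i, is_exp (l i) (s \o a i \o s)) (l0 : \sum_(i < n) l i = 0).

(* Averaging the weighted means of [y] with the [a i] contracts the Thompson  *)
(* distance to [x = r \o r]. Replacing [a i] by                               *)
(* [r (1 + l i / N) ^ N r], whose mean with [x] is [r (1 + l i / N) r], costs *)
(* [eps / N], and the average of the latter over [i] is [x].                  *)
Lemma average_contraction (eps : R) : 0 < eps ->
  exists m, forall y th, A y -> posdef y -> thompson_le y (r \o r) th ->
    exists y', [/\ A y', posdef y' &
      thompson_le y' (r \o r) ((1 - 2^-1 ^+ m) * th + 2^-1 ^+ m * eps)].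
Proof.
move=> eps0.
have px : posdef (r \o r) := posdef_sqr dot_norm sr k0 hr.
have ss : selfadj s := inverse_selfadj sr k0 hr irs.
have [[lr [K K0 bK]] _] := sr.
have hs v : K^-1 * nrm v <= nrm (s v).
  by rewrite ler_pdivrMl //; have := bK (s v); rewrite (inverseKV irs).
have pu i : posdef (s \o a i \o s) by apply: (posdef_conj ss _ hs (pa i)); rewrite
  invr_gt0.
have /choice [M hM] i := log_approx (pu i) (sl i) (hl i) eps0.
pose m := \max_i M i; exists m => y th Ay py [le_yx le_xy].
pose p i := id + real_complex R (2 ^ m)%:R^-1 *: l i.
have hp i : [/\ posdef (p i), le_op (s \o a i \o s) (real_complex R (expR eps) *: iter
  (2 ^ m) (p i))
      & le_op (iter (2 ^ m) (p i)) (real_complex R (expR eps) *: (s \o a i \o s))].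
  by apply: hM; exact: leq_bigmax.
pose b i := r \o iter (2 ^ m) (p i) \o r.
pose h i := r \o p i \o r.
have ph i : posdef (h i) by apply: (posdef_conj sr k0 hr); have [] := hp i.
have mh i : wmean m (r \o r) (b i) (h i).
  by apply: (wmean_conj _ sr k0 hr irs); have [] := hp i.
have ea i : a i = r \o (s \o a i \o s) \o r.
  by apply/funext => v; rewrite /= (inverseKV irs) (inverseK irs).
have conjE T v : qform (r \o T \o r) v = qform T (r v) by exact: qform_conj.
have le_ab i : le_op (a i) (real_complex R (expR eps) *: b i).
  move=> v; rewrite ea qformZ !conjE -qformZ.
  by have [_ h1 _] := hp i; exact: h1.
have le_ba i : le_op (b i) (real_complex R (expR eps) *: a i).
  move=> v; rewrite [a i]ea qformZ !conjE -qformZ.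
  by have [_ _ h1] := hp i; exact: h1.
have /choice [g hg] i := cstar_wmean m Ay py (Aa i) (pa i).
have hgh i : le_op (g i) (real_complex R (expR ((1 - 2^-1 ^+ m) * th + 2^-1 ^+ m *
  eps)) *: h i).
  have [_ pg mg] := hg i.
  exact: (wmean_le dot_norm py px pg (ph i) mg (mh i) le_yx (le_ab i)).
have hhg i : le_op (h i) (real_complex R (expR ((1 - 2^-1 ^+ m) * th + 2^-1 ^+ m *
  eps)) *: g i).
  have [_ pg mg] := hg i.
  exact: (wmean_le dot_norm px py (ph i) pg (mh i) mg le_xy (le_ba i)).
set t := _ + _ in hgh hhg *.
have n0 : 0 < n%:R :> R by rewrite ltr0n.
(* This is where the Karcher equation enters: the forms of the [l i] at [r v] add up to zero. *)
have sum_h v : \sum_(i < n) qform (h i) v = n%:R * qform (r \o r) v.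
  rewrite /h; under eq_bigr do rewrite conjE qformD qformZ.
  rewrite big_split /= -mulr_sumr -(qform_sum l) l0 {2}/qform ip0l mulr0 addr0.
  by rewrite sumr_const card_ord mulr_natl /qform /= [in RHS]sr.2.
exists (real_complex R n%:R^-1 *: \sum_(i < n) g i); split.
- by apply: (cstar_scale hA); apply: cstar_sum => i; have [] := hg i.
- by apply: posdefZ; [rewrite invr_gt0|apply: posdef_sum => // i; have [] := hg i].
split=> v; rewrite !qformZ qform_sum.
  rewrite ler_pdivrMl // mulrCA -sum_h mulr_sumr; apply: ler_sum => i _.
  by rewrite -qformZ; exact: hgh.
rewrite mulrCA ler_pdivlMl // -sum_h mulr_sumr; apply: ler_sum => i _.
by rewrite -qformZ; exact: hhg.
Qed.

Lemma karcher_solution_approx (e : R) : 0 < e ->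
  exists2 y, A y & opnorm_le (y - (r \o r)) e.
Proof.
move=> e0.
have px : posdef (r \o r) := posdef_sqr dot_norm sr k0 hr.
have [[[_ [M M0 bM]] _] [c c0 hc]] := px.
have eM : 0 < e / M by rewrite divr_gt0.
(* One half is for the limit error, the other for the decaying term [(1 - t) ^ j * th0]. A total
   distance [ln (1 + e / M)] means [y <= (1 + e / M) x], and [x <= M] turns the excess into [e]. *)
pose eps := ln (1 + e / M) / 2.
have eps0 : 0 < eps by rewrite divr_gt0 // ln_gt0 // ltrDl.
have [m step] := average_contraction eps0.
set t := 2^-1 ^+ m in step.
have t0 : 0 < t by rewrite exprn_gt0 ?invr_gt0.
have t1 : t <= 1 by rewrite exprn_ile1 // ?invr_ge0 // invf_le1 // ler1n.
(* From [c <= x <= M]; [expR th0 >= 1 + th0] dominates both [c^-1] and [M]. *)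
pose th0 := c^-1 + M.
have ic0 : 0 < c^-1 by rewrite invr_gt0.
have D0 : thompson_le id (r \o r) th0.
  have := expR_ge1Dx th0; rewrite /th0 => h.
  have qid w : qform id w = nrm w ^+ 2 by rewrite /qform ipvv.
  split=> v; rewrite qformZ qid.
    have h1 : nrm v ^+ 2 <= c^-1 * qform (r \o r) v by rewrite ler_pdivlMl.
    apply: le_trans h1 _; rewrite ler_wpM2r ?posdef_ge0 //; lra.
  apply: le_trans (qform_ub dot_norm v bM) _.
  by rewrite ler_wpM2r ?sqr_ge0 //; lra.
have iterD j : exists y, [/\ A y, posdef y & thompson_le y (r \o r) ((1 - t) ^+ j * th0
  + eps)].
  elim: j => [|j [y [Ay py Dy]]].
    exists id; split; [exact: (cstar_one hA)|exact: posdef_id|].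
    apply: thompson_leW D0 => //; first exact: posdef_id.
    by rewrite expr0 mul1r lerDl ltW.
  have [y' [Ay' py' Dy']] := step _ _ Ay py Dy; exists y'; split=> //.
  apply: thompson_leW Dy' => //.
  by rewrite exprS; lra.
have [j hj] : exists j, th0 * (1 - t) ^+ j <= eps.
  have [||N hN] := @geometric_small _ th0 (1 - t) eps _ _ eps0; [lra|lra|].
  by exists N; apply: hN.
have [y [Ay py Dy]] := iterD j.
have {Dy} [h1 h2] : thompson_le y (r \o r) (ln (1 + e / M)).
  apply: thompson_leW Dy => //; rewrite mulrC; rewrite /eps in hj *; lra.
exists y => //.
have sd : selfadj (y - (r \o r)) by apply: selfadjB; [exact: py.1|exact: px.1].
apply: opnorm_le_qform => // v.
have -> : qform (y - (r \o r)) v = qform y v - qform (r \o r) v by rewrite /qform !opE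
  !ipE.
have := h1 v; have := h2 v; rewrite !qformZ lnK ?posrE ?addr_gt0 //.
have := qform_ub dot_norm v bM; have := posdef_ge0 px v; have := posdef_ge0 py v.
set q := qform y v; set x := qform (r \o r) v; set d := nrm v ^+ 2 => q0 x0 hx h3 h4.
have ed : e / M * x <= e * d.
  by rewrite mulrAC ler_pdivrMr // -mulrA ler_pM2l // mulrC.
rewrite ler_norml; apply/andP; split; last lra.
have ex0 : 0 <= e / M * x by rewrite mulr_ge0 // ltW.
(* The lower bound is [x <= (1 + e / M) * q], whose error involves [q]; when [q <= x] it is at most
   the one with [x], and otherwise [q - x] is positive. *)
have [qx|xq] := lerP q x; last by lra.
have : e / M * q <= e / M * x by rewrite ler_pM2l.
lra.
Qed.

End Iteration.
End KarcherMean.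

Theorem lemma7p3 (R : realType) (E : completeNormedModType R[i])
    (dot : {dot E for (Num.conj : R[i] -> R[i])})
    (dot_norm : forall v : E, dot v v = `|v| ^+ 2)
    (A : set (E -> E)) (hA : is_cstar_subalgebra dot A)
    (n : nat) (n_gt0 : (0 < n)%N)
    (a : 'I_n -> E -> E) (ha : forall i, pos_cone dot A (a i))
    (x : E -> E) (hx : is_karcher_mean dot a x) :
  pos_cone dot A x.
Proof.
have [px [s [l [[r [pr rr] irs] hlog l0]]]] := hx.
have {}px : posdef dot x by apply: pos_cone_posdef px.
(* What remains is the membership [A x]. *)
apply: posdef_pos_cone => //.
have [sr _] := positive_selfadj dot_norm (@subset_refl _ _) pr.
have [_ [K K0 bK]] := sr.1.
have [m m0 hm] := posdef_lower_bound dot_norm px.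
have mK0 : 0 < m / K by rewrite divr_gt0.
(* [m * nrm v <= nrm (x v) = nrm (r (r v)) <= K * nrm (r v)]. *)
have hr v : m / K * nrm v <= nrm (r v).
  rewrite mulrAC ler_pdivrMr // mulrC [leRHS]mulrC.
  by apply: le_trans (bK (r v)); rewrite mulrC -[r (r v)]/((r \o r) v) rr.
apply: (cstar_norm_closed hA); first exact: px.1.1.
rewrite -rr; apply: (karcher_solution_approx dot_norm hA n_gt0 (a := a) (l := l) _ _ sr
  mK0 hr irs) => //.
- by move=> i; have [_ []] := ha i.
- by move=> i; apply: pos_cone_posdef (ha i) => //; exact: cstar_bounded hA.
- by move=> i; have [b adj _] := hlog i; split; [exact/bounded_op_bounded|exact:
  ip_adjoint].
- by move=> i; have [] := hlog i.
Qed.
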